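(* Let $q$ be an odd positive integer with $q<2^{32}$, and let $m$ be a positive integer with $m\leq q$ and $m \mid q\cdot 2^{q-1}$. Then $P_m$ divides $Q_q$.
   Context: $Q_q$ denotes the $q$-dimensional hypercube graph: vertices are the $q$-tuples of $0$'s and $1$'s, two vertices adjacent iff they differ in exactly one coordinate. $P_m$ denotes the path with $m$ edges (vertices $0,1,\dots,m$, edges joining $j-1$ and $j$). For graphs $H$ and $G$, ''$H$ divides $G$'' means there is a collection of subgraphs $H_i$ of $G$, each isomorphic to $H$, such that $E(G)$ is the disjoint union of the edge sets $E(H_i)$. *)

(* Defs.v *)
(* Simple graphs are represented by a finite vertex type V
   together with an edge set E : {set {set V}} whose elements are 2-subsets. *)
From mathcomp Require Import all_boot.
Set Implicit Arguments. Unset Strict Implicit. Unset Printing Implicit Defensive.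

Definition hcube_vert (q : nat) := {ffun 'I_q -> bool}.

Definition hcube_edges (q : nat) : {set {set hcube_vert q}} :=
  [set e : {set hcube_vert q} |
     [exists u : hcube_vert q, exists v : hcube_vert q,
        (#|[set i : 'I_q | u i != v i]| == 1) && (e == [set u; v])]].

Definition path_edges (m : nat) : {set {set 'I_m.+1}} :=
  [set e : {set 'I_m.+1} |
     [exists i : 'I_m.+1, exists j : 'I_m.+1,
        (nat_of_ord j == (nat_of_ord i).+1) && (e == [set i; j])]].

Definition is_subgraph (V : finType) (EG : {set {set V}})
    (S : {set V}) (F : {set {set V}}) : Prop :=
  F \subset EG /\ (forall e, e \in F -> e \subset S).

Definition isomorphic_to (W V : finType) (EH : {set {set W}})
    (S : {set V}) (F : {set {set V}}) : Prop :=
  exists phi : W -> V,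
    [/\ injective phi, phi @: [set: W] = S & F = [set phi @: (e : {set W}) | e in EH]].

Definition graph_divides (W V : finType) (EH : {set {set W}})
    (EG : {set {set V}}) : Prop :=
  exists (k : nat) (S : 'I_k -> {set V}) (F : 'I_k -> {set {set V}}),
    [/\ forall i, is_subgraph EG (S i) (F i),
        forall i, isomorphic_to EH (S i) (F i),
        forall i j, i != j -> [disjoint F i & F j]
      & \bigcup_(i < k) F i = EG].

(* Main.v *)
(* Write m = 2^a d and q = k d with d odd, so that 2^a <= k.

   Blowing up every coordinate of Q_k to d coordinates: Q_(kd) is a union of
   copies of Q_k whose edges are replaced by antipodal paths of Q_d, so P_(2^a)
   dividing Q_k gives P_(2^a d) dividing Q_(kd).  Since a path of length 2^b
   splits into paths of length 2^a, only 2^b < k < 2^(b+1) matters.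

   Put M = 2^b and k = M + r with r odd, and Q_k = Q_r x Q_M.  By induction on
   b, for every alpha <= M/2 an orientation of Q_M splits into M/2 permutations,
   alpha of which, applied in turn, trace a path from every vertex, while the
   other ones have only cycles of length divisible by 2M.  Choose
   alpha1 + r + alpha2 = M.  For even z in Q_r and y in Q_M, go from (z, y) to
   (-z, y) by changing the r coordinates in order; prepend a path of length
   alpha1 in {z} x Q_M and append one of length alpha2 in {-z} x Q_M.  What is
   left consists of cycles of length divisible by 2M, which are cut into paths
   of length M. *)
Require Import Defs.
From mathcomp Require Import all_boot zify.
Set Implicit Arguments. Unset Strict Implicit. Unset Printing Implicit Defensive.

(** * Cubes, and path decompositions along an orientation *)

Definition flip (I : finType) (i : I) (x : {ffun I -> bool}) :
  {ffun I -> bool} := [ffun j => (j == i) (+) x j].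

Definition cube_adj (I : finType) (x y : {ffun I -> bool}) : Prop :=
  exists i, y = flip i x.

Definition parity (I : finType) (x : {ffun I -> bool}) : bool :=
  \big[addb/false]_i x i.

Lemma flipK (I : finType) (i : I) : involutive (flip i).
Proof. by move=> x; apply/ffunP=> j; rewrite !ffunE addbA addbb. Qed.

Lemma flip_inj2 (I : finType) (i j : I) x : flip i x = flip j x -> i = j.
Proof.
move/ffunP/(_ i); rewrite !ffunE eqxx; case: eqP => // _.
by case: (x i).
Qed.

Lemma parity_flip (I : finType) (i : I) x : parity (flip i x) = ~~ parity x.
Proof.
rewrite /parity (bigD1 i) //= [in RHS](bigD1 i) //= ffunE eqxx -addNb.
congr (_ (+) _); apply: eq_bigr => j /negPf ji.
by rewrite ffunE ji.
Qed.

(* The graph is oriented along the paths, so that covering every edge exactly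
   once means covering every arc of the orientation [O] exactly once. *)
Definition path_decomp (V : finType) (O : V -> V -> Prop) (m : nat) : Prop :=
  exists (I : finType) (D : pred I) (p : I -> nat -> V),
    [/\ forall i a, D i -> a < m -> O (p i a) (p i a.+1),
        forall i a b, D i -> a <= m -> b <= m -> p i a = p i b -> a = b,
        forall x y, O x y ->
          exists i a, [/\ D i, a < m, p i a = x & p i a.+1 = y]
      & forall i j a b, D i -> D j -> a < m -> b < m ->
          p i a = p j b -> p i a.+1 = p j b.+1 -> i = j].

Definition orientation (V : finType) (E O : V -> V -> Prop) : Prop :=
  (forall x y, E x y <-> O x y \/ O y x) /\ (forall x y, O x y -> ~ O y x).

Definition path_divides (V : finType) (E : V -> V -> Prop) (m : nat) : Prop :=
  exists2 O, orientation E O & path_decomp O m.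

(** Coordinates may be indexed by any type of size [n], so that sums and products of index types
    serve directly for products and blocks of cubes. *)
Definition is_cube (n : nat) (V : finType) (E : V -> V -> Prop) : Prop :=
  exists (I : finType) (f : V -> {ffun I -> bool}),
    [/\ #|I| = n, bijective f & forall x y, E x y <-> cube_adj (f x) (f y)].

Definition prod_adj (V W : finType) (E : V -> V -> Prop) (F : W -> W -> Prop)
    (x y : V * W) : Prop :=
  (x.1 = y.1 /\ F x.2 y.2) \/ (x.2 = y.2 /\ E x.1 y.1).

Lemma path_divides_bij (V W : finType) (E : V -> V -> Prop)
    (F : W -> W -> Prop) (f : V -> W) m :
  bijective f -> (forall x y, E x y <-> F (f x) (f y)) ->
  path_divides E m -> path_divides F m.
Proof.
case=> g fK gK EF [O [EO asym] [I [D [p [p1 p2 p3 p4]]]]].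
have fI := can_inj fK.
exists (fun x y => O (g x) (g y)).
  split=> [x y|x y]; last exact: asym.
  by rewrite -EO EF !gK.
exists I, D, (fun i a => f (p i a)); split.
- by move=> i a Di am; rewrite !fK; apply: p1.
- by move=> i a b Di am bm /fI; apply: p2.
- move=> x y /p3[i [a [Di am e1 e2]]].
  by exists i, a; rewrite e1 e2 !gK.
- by move=> i j a b Di Dj am bm /fI e1 /fI; apply: p4.
Qed.

Lemma path_divides_cube n (V : finType) (E : V -> V -> Prop) m :
  is_cube n E -> path_divides E m -> path_divides (@cube_adj 'I_n) m.
Proof.
case=> I [f [cI fB Ef]]; subst n.
have gB : bijective (fun x : {ffun I -> bool} =>
    [ffun i : 'I_#|I| => x (enum_val i)]).
  exists (fun y : {ffun 'I_#|I| -> bool} => [ffun i => y (enum_rank i)]).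
    by move=> x; apply/ffunP=> i; rewrite !ffunE enum_rankK.
  by move=> x; apply/ffunP=> i; rewrite !ffunE enum_valK.
apply: (path_divides_bij (bij_comp gB fB)) => x y.
rewrite Ef /=; split=> [[i ->]|[i e]].
  exists (enum_rank i); apply/ffunP=> j.
  by rewrite !ffunE -(inj_eq enum_val_inj) enum_rankK.
exists (enum_val i); apply: (bij_inj gB); rewrite e.
by apply/ffunP=> j; rewrite !ffunE (inj_eq enum_val_inj).
Qed.

Lemma is_cube_prod n k (V W : finType) (E : V -> V -> Prop)
    (F : W -> W -> Prop) :
  is_cube n E -> is_cube k F -> is_cube (n + k) (prod_adj E F).
Proof.
move=> [I [f [cI [f' fK f'K] Ef]]] [J [g [cJ [g' gK g'K] Fg]]].
pose u (s : V * W) : {ffun I + J -> bool} :=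
  [ffun k => match k with inl i => f s.1 i | inr j => g s.2 j end].
pose v (x : {ffun I + J -> bool}) : V * W :=
  (f' [ffun i => x (inl i)], g' [ffun j => x (inr j)]).
have uK : cancel u v.
  case=> x y; congr (_, _); [rewrite -[RHS]fK|rewrite -[RHS]gK];
  by congr (_ _); apply/ffunP=> i; rewrite !ffunE.
have vK : cancel v u.
  by move=> x; apply/ffunP=> -[i|j]; rewrite ffunE /= ?f'K ?g'K ffunE.
exists (I + J)%type, u; split; first by rewrite card_sum cI cJ.
  by exists v.
move=> [x y] [x' y']; split.
  case=> /= -[<-]; [move/Fg=> [j e]; exists (inr j)|move/Ef=> [i e]; exists (inl i)];
  by apply/ffunP=> -[l|l]; rewrite !ffunE /= ?e ?ffunE.
case=> -[i|j] /ffunP e; [right|left]; split=> /=.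
- by apply: (can_inj gK); apply/ffunP=> l; have := e (inr l); rewrite !ffunE.
- by apply/Ef; exists i; apply/ffunP=> l; have := e (inl l); rewrite !ffunE.
- by apply: (can_inj fK); apply/ffunP=> l; have := e (inl l); rewrite !ffunE.
- by apply/Fg; exists j; apply/ffunP=> l; have := e (inr l); rewrite !ffunE.
Qed.

(** Each long path is cut into [l] consecutive pieces, piece [k] starting at position [k * m]. *)
Lemma path_divides_mul (V : finType) (E : V -> V -> Prop) m l :
  0 < m -> path_divides E (m * l) -> path_divides E m.
Proof.
move=> m0 [O EO [I [D [p [p1 p2 p3 p4]]]]]; exists O => //.
have le (k : 'I_l) a : a <= m -> k * m + a <= m * l.
  move=> am; rewrite mulnC.
  by have := ltn_ord k; rewrite -(leq_pmul2l m0) mulnS; lia.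
have lt (k : 'I_l) a : a < m -> k * m + a < m * l.
  by move=> am; rewrite -addnS; apply: le.
exists (I * 'I_l)%type, (fun s => D s.1), (fun (s : I * 'I_l) a => p s.1 (s.2 * m + a)).
split=> /=.
- by move=> [i k] a Di am /=; rewrite addnS; apply: p1 => //; apply: lt.
- move=> [i k] a b /= Di am bm e.
  by apply/eqP; rewrite -(eqn_add2l (k * m)); apply/eqP/(p2 i) => //; apply: le.
- move=> x y /p3[i [a [Di am e1 e2]]].
  have kl : a %/ m < l by rewrite ltn_divLR // mulnC.
  exists (i, Ordinal kl), (a %% m) => /=; rewrite ltn_mod.
  by rewrite addnS -divn_eq.
- move=> [i k] [j k'] a b /= Di Dj am bm; rewrite !addnS => e1 e2.
  have ij : i = j by apply: (p4 _ _ _ _ Di Dj _ _ e1 e2); apply: lt.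
  subst j; congr (_, _); apply: val_inj => /=.
  have := p2 _ _ _ Di (ltnW (lt k a am)) (ltnW (lt k' b bm)) e1.
  move/(congr1 (divn^~ m)).
  by rewrite !divnMDl // !divn_small // !addn0.
Qed.

(** An orientation contains each edge in one direction only, so paths without a common arc have no
    common edge. *)
Lemma path_graph_divides q m :
  path_divides (@cube_adj 'I_q) m ->
  graph_divides (path_edges m) (hcube_edges q).
Proof.
case=> O [EO asym] [I [D [p [p1 p2 p3 p4]]]].
have adjP (u v : hcube_vert q) :
    reflect (cube_adj u v) (#|[set i | u i != v i]| == 1).
  apply: (iffP cards1P) => [[i /setP e]|[i ->]]; exists i.
    apply/ffunP=> j; have := e j; rewrite !inE ffunE => <-.
    by case: (u j); case: (v j).
  by apply/setP=> j; rewrite !inE ffunE; case: (j == i); case: (u j).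
have edgeP e : reflect (exists u v, O u v /\ e = [set u; v])
    (e \in hcube_edges q).
  rewrite inE; apply: (iffP existsP) => [[u /existsP[v /andP[/adjP]]]|].
    by case/EO=> Ouv /eqP ->; [exists u, v|exists v, u; rewrite setUC].
  case=> u [v [Ouv ->]]; exists u; apply/existsP; exists v; rewrite eqxx andbT.
  by apply/adjP/EO; left.
pose ph (k : 'I_#|D|) (a : 'I_m.+1) : hcube_vert q := p (enum_val k) a.
have Dk (k : 'I_#|D|) : D (enum_val k) by exact: (enum_valP k).
pose F k := [set ph k @: (e : {set _}) | e in path_edges m].
have FP k e : reflect (exists2 a, a < m &
    e = [set p (enum_val k) a; p (enum_val k) a.+1]) (e \in F k).
  apply: (iffP imsetP) => [[s]|[a am ->]].
    rewrite inE => /existsP[i /existsP[j /andP[/eqP ji /eqP ->]]] ->.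
    exists i; first by rewrite -ltnS -ji.
    by rewrite imsetU !imset_set1 /ph ji.
  have am' : a < m.+1 by apply: ltnW.
  exists [set Ordinal am'; Ordinal (am : a.+1 < m.+1)].
    by rewrite inE; apply/existsP; eexists; apply/existsP; eexists;
       apply/andP; split; last exact: eqxx.
  by rewrite imsetU !imset_set1.
have FO k e : e \in F k -> e \in hcube_edges q.
  by case/FP=> a am ->; apply/edgeP; do 2 eexists; split; last by [];
  exact: (p1 _ _ (Dk k) am).
exists #|D|, (fun k => ph k @: setT), F; split.
- move=> k; split; first by apply/subsetP=> e; apply: FO.
  by move=> e /imsetP[s _ ->]; apply: imsetS; apply: subsetT.
- move=> k; exists (ph k); split=> // a b e.
  by apply: val_inj; apply: (p2 _ _ _ (Dk k) _ _ e); rewrite -ltnS.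
- move=> k l kl; apply/pred0P=> e /=; apply/negP=> /andP[/FP[a am ->]].
  case/FP=> b bm /setP e2.
  have Oa := p1 _ _ (Dk k) am; have Ob := p1 _ _ (Dk l) bm.
  have ne (x : hcube_vert q) y : O x y -> x != y.
    by move=> Oxy; apply/eqP=> xy; subst y; case: (asym _ _ Oxy).
  (* The endpoints can match in four ways: two make an arc degenerate, the crossed one reverses an
     arc of [O], and the parallel one falls under [p4]. *)
  have := e2 (p (enum_val k) a); have := e2 (p (enum_val k) a.+1).
  have := ne _ _ Oa; rewrite !inE !eqxx orbT /=.
  move=> nk /esym/orP[]/eqP ea1 /esym/orP[]/eqP ea.
  + by rewrite ea ea1 eqxx in nk.
  + by rewrite ea ea1 in Oa; case: (asym _ _ Oa).
  + by case/eqP: kl; apply: enum_val_inj; apply: (p4 _ _ a b).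
  + by rewrite ea ea1 eqxx in nk.
- apply/setP=> e; apply/bigcupP/idP => [[k _]|]; first exact: FO.
  case/edgeP=> u [v [/p3[i [a [Di am <- <-]]] ->]].
  exists (enum_rank_in (Di : i \in D) i) => //; apply/FP; exists a => //.
  by rewrite enum_rankK_in.
Qed.

(** * Splitting the cube into permutations *)

Fixpoint follow (V : Type) (h : nat -> V -> V) (n : nat) (x : V) : V :=
  if n is k.+1 then h k (follow h k x) else x.

(* An orientation of [E] split into [c] permutations.  Applying the first
   [alpha] of them in turn traces a path from every vertex; every cycle of the
   others has length divisible by [L], as witnessed by the potentials [phi]. *)
Record splitting (V : finType) (E : V -> V -> Prop) (par : V -> bool)
    (c alpha L : nat) (h : nat -> V -> V) (phi : nat -> V -> nat) : Prop :=
  Splitting {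
    split_inj : forall i, i < c -> injective (h i);
    split_adj : forall x y,
      E x y <-> exists2 i, i < c & y = h i x \/ x = h i y;
    split_eq : forall i j x, i < c -> j < c -> h i x = h j x -> i = j;
    split_rev : forall i j x, i < c -> j < c -> h i (h j x) <> x;
    split_par : forall i x, i < c -> par (h i x) = ~~ par x;
    split_level : forall i x, alpha <= i -> i < c ->
      phi i (h i x) = (phi i x).+1 %[mod L];
    split_path : forall x a b, a <= alpha -> b <= alpha ->
      follow h a x = follow h b x -> a = b }.

Definition prod_par (V : finType) (par : V -> bool) (x : V * V) : bool :=
  par x.1 (+) par x.2.

(* Factors [2j] and [2j+1] of the product use the arcs of factor [j] in both
   coordinates: unmixed below index [n], and above it alternating between the
   coordinates, which doubles the length of the cycles. *)
Definition on_left (V : finType) (par : V -> bool) n i (x : V * V) : bool :=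
  if i < n then ~~ odd i else prod_par par x == odd i.

Definition mix (V : finType) (par : V -> bool) n (h1 h2 : nat -> V -> V)
    (i : nat) (x : V * V) : V * V :=
  if on_left par n i x then (h1 i./2 x.1, x.2) else (x.1, h2 i./2 x.2).

(** For a mixed factor, the coordinate tracked is the one that moves at even vertices. Its potential
    advances every second step and is therefore doubled; adding [-1] modulo [L.*2] at odd vertices
    makes every single step count for one. *)
Definition mix_phi (V : finType) (par : V -> bool) L
    (phi1 phi2 : nat -> V -> nat) (i : nat) (x : V * V) : nat :=
  (if odd i then phi2 i./2 x.2 else phi1 i./2 x.1).*2
    + prod_par par x * (L.*2).-1.

(** Below [(alpha./2).*2] the factors move left and right in turn, tracing a path in both
    coordinates at once. For odd [alpha] one mixed factor adds the last arc. *)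
Lemma splitting_prod (V : finType) (E : V -> V -> Prop) (par : V -> bool)
    (c alpha L : nat) (h1 h2 : nat -> V -> V) (phi1 phi2 : nat -> V -> nat) :
  0 < L -> alpha <= c.*2 ->
  splitting E par c (uphalf alpha) L h1 phi1 ->
  splitting E par c alpha./2 L h2 phi2 ->
  splitting (prod_adj E E) (prod_par par) c.*2 alpha L.*2
    (mix par (alpha./2).*2 h1 h2) (mix_phi par L phi1 phi2).
Proof.
move=> L0 ac S1 S2; set n := (alpha./2).*2.
have half i : i < c.*2 -> i./2 < c by lia.
have par1 i x : i < c.*2 -> par (h1 i./2 x) = ~~ par x.
  by move=> ic; apply: (split_par S1); apply: half.
have par2 i x : i < c.*2 -> par (h2 i./2 x) = ~~ par x.
  by move=> ic; apply: (split_par S2); apply: half.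
have parM i x : i < c.*2 ->
    prod_par par (mix par n h1 h2 i x) = ~~ prod_par par x.
  move=> ic; rewrite /prod_par /mix; case: on_left => /=.
    by rewrite par1 // addNb.
  by rewrite par2 // addbN.
have nfix (h : nat -> V -> V) i x :
    par (h i x) = ~~ par x -> h i x <> x.
  by move=> e1 e2; move: e1; rewrite e2; case: (par x).
split.
- move=> i ic x y e.
  (* Every factor flips the parity, so equal images come from vertices of equal parity, which move
     in the same coordinate. *)
  have: on_left par n i x = on_left par n i y.
    rewrite /on_left; case: ifP => // _.
    by move: (congr1 (prod_par par) e); rewrite !parM // => /negb_inj ->.
  move=> eL; move: e; rewrite /mix eL; case: on_left => -[];
  case: x {eL} => x1 x2; case: y => y1 y2 /=.
    by move=> /(split_inj S1 (half _ ic)) -> ->.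
  by move=> -> /(split_inj S2 (half _ ic)) ->.
(* The low bit of the index selects the coordinate, after correction by the parity of [x] if the
   factor is mixed. *)
- have arc x j b : j < c -> exists2 i, i < c.*2 &
      mix par n h1 h2 i x = if b then (h1 j x.1, x.2) else (x.1, h2 j x.2).
    move=> jc.
    have [jn|jn] := ltnP j alpha./2.
      exists (~~ b + j.*2); first by case: (b); lia.
      rewrite /mix /on_left half_bit_double oddD odd_double addbF.
      have -> : ~~ b + j.*2 < n by rewrite /n; case: (b); lia.
      by rewrite oddb negbK.
    exists ((prod_par par x (+) ~~ b) + j.*2); first by case: (_ (+) _); lia.
    rewrite /mix /on_left half_bit_double oddD odd_double addbF.
    have -> : (prod_par par x (+) ~~ b) + j.*2 < n = false.
      by rewrite /n; case: (_ (+) _); lia.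
    by rewrite oddb; case: (prod_par par x); case: (b).
  move=> x y; split.
    case=> -[e].
      case/(split_adj S2)=> j jc [] e2.
        have [i ic ei] := arc x j false jc; exists i => //; left.
        by rewrite ei -e2 e; case: (y).
      have [i ic ei] := arc y j false jc; exists i => //; right.
      by rewrite ei -e2 -e; case: (x).
    case/(split_adj S1)=> j jc [] e2.
      have [i ic ei] := arc x j true jc; exists i => //; left.
      by rewrite ei -e2 e; case: (y).
    have [i ic ei] := arc y j true jc; exists i => //; right.
    by rewrite ei -e2 -e; case: (x).
  have adj z i : i < c.*2 -> prod_adj E E z (mix par n h1 h2 i z).
    move=> ic; rewrite /mix; case: on_left; [right|left]; split=> //=.
      by apply/(split_adj S1); exists i./2; [apply: half|left].
    by apply/(split_adj S2); exists i./2; [apply: half|left].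
  have adjC z i : i < c.*2 -> prod_adj E E (mix par n h1 h2 i z) z.
    move=> ic; rewrite /mix; case: on_left; [right|left]; split=> //=.
      by apply/(split_adj S1); exists i./2; [apply: half|right].
    by apply/(split_adj S2); exists i./2; [apply: half|right].
  by case=> i ic [] ->; [apply: adj|apply: adjC].
- move=> i j x ic jc; rewrite /mix.
  have odd_half : i./2 = j./2 -> on_left par n i x = on_left par n j x -> i = j.
    rewrite /on_left => e.
    have -> : (i < n) = (j < n) by rewrite /n; lia.
    move=> e'; have eo : odd i = odd j.
      move: e'; case: (j < n); first by move/negb_inj.
      by case: prod_par; case: (odd i); case: (odd j).
    by rewrite -(odd_double_half i) -(odd_double_half j) e eo.
  case ei: (on_left par n i x); case ej: (on_left par n j x) => -[].
  + move/(split_eq S1 (half _ ic) (half _ jc)) => e.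
    by apply: odd_half; rewrite ?ei ?ej.
  + by move/nfix; case; apply: par1.
  + by move/esym/nfix; case; apply: par1.
  + move/(split_eq S2 (half _ ic) (half _ jc)) => e.
    by apply: odd_half; rewrite ?ei ?ej.
- move=> i j x ic jc; rewrite {1}/mix; case: on_left; rewrite /mix;
    case: on_left; case: x => x1 x2 /= -[].
  + by apply: (split_rev S1); apply: half.
  + by move/nfix; case; apply: par1.
  + by move=> + _; move/nfix; case; apply: par1.
  + by apply: (split_rev S2); apply: half.
- exact: parM.
- move=> i x ai ic; rewrite /mix_phi parM // /mix /on_left.
  have -> : (i < n) = false by rewrite /n; lia.
  have L1 : (L.*2).-1.+1 = L.*2 by lia.
  have wrap u v : u = v.+1 %[mod L] ->
      u.*2 + (L.*2).-1 = v.*2.+1 %[mod L.*2].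
    move=> e; have /eqP : u.*2 = (v.+1).*2 %[mod L.*2].
      by rewrite -!muln2 -!muln_modl e.
    rewrite -(eqn_modDr (L.*2).-1) => /eqP ->.
    have -> : (v.+1).*2 + (L.*2).-1 = v.*2.+1 + L.*2 by lia.
    exact: modnDr.
  (* Only an even [i] needs [phi1], and [alpha <= i] then gives [uphalf alpha <= i./2]; for odd [i]
     the bound [alpha./2 <= i./2] suffices. *)
  have lev1 : ~~ odd i -> phi1 i./2 (h1 i./2 x.1) = (phi1 i./2 x.1).+1 %[mod L].
    by move=> oi; apply: (split_level S1); lia.
  have lev2 : odd i -> phi2 i./2 (h2 i./2 x.2) = (phi2 i./2 x.2).+1 %[mod L].
    by move=> oi; apply: (split_level S2); lia.
  case oi: (odd i) lev1 lev2 => lev1 lev2;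
  case: (prod_par par x) => /=; rewrite ?mul1n ?mul0n ?addn0.
  + by rewrite -addnS L1 modnDr.
  + by apply: wrap; apply: lev2.
  + by rewrite -addnS L1 modnDr.
  + by apply: wrap; apply: lev1.
- have low x a : a <= n -> follow (mix par n h1 h2) a x =
      (follow h1 (uphalf a) x.1, follow h2 a./2 x.2).
    elim: a => [|a IH] an; first by case: x.
    rewrite /= IH; last by lia.
    rewrite /mix /on_left an; case oa: (odd a) => /=.
      have -> : uphalf a = a./2.+1 by lia.
      by [].
    by have -> : uphalf a = a./2 by lia.
  have lowI x a b : a <= n -> b <= n ->
      follow (mix par n h1 h2) a x = follow (mix par n h1 h2) b x -> a = b.
    move=> an bn; rewrite !low // => -[].
    move/(split_path S1) => e1 /(split_path S2) e2.
    have {}e1 : uphalf a = uphalf b by apply: e1; rewrite /n in an bn; lia.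
    have {}e2 : a./2 = b./2 by apply: e2; rewrite /n in an bn; lia.
    lia.
  (* The mixed last step may go left, which prolongs the left path, or right. In the second case a
     revisited vertex has position [n] or [n.-1], which would give a fixed point or a reversed arc
     of [h2]. *)
  have last x b : n < alpha -> b <= n ->
      follow (mix par n h1 h2) n.+1 x <> follow (mix par n h1 h2) b x.
    move=> na bn; have kc : alpha./2 < c by lia.
    rewrite [follow _ n.+1 _]/= !low // {1}/mix doubleK.
    have -> : uphalf n = alpha./2 by rewrite /n; lia.
    case: on_left => /= -[].
      rewrite -[h1 _ _]/(follow h1 (alpha./2).+1 x.1).
      move/(split_path S1) => e1 _.
      have : (alpha./2).+1 = uphalf b by apply: e1; rewrite /n in na bn; lia.
      by rewrite /n in na bn; lia.
    move/(split_path S1) => e1.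
    have {}e1 : alpha./2 = uphalf b by apply: e1; rewrite /n in na bn; lia.
    have [ob|ob] := boolP (odd b); last first.
      have <- : alpha./2 = b./2 by lia.
      by move/nfix; case; apply: (split_par S2).
    have -> : alpha./2 = (b./2).+1 by lia.
    by apply: (split_rev S2); lia.
  move=> x a b aa ba.
  have [an|na] := leqP a n; have [bn|nb] := leqP b n.
  + exact: lowI.
  + have -> : b = n.+1 by rewrite /n in nb *; lia.
    by move/esym/last; case=> //; rewrite /n in nb *; lia.
  + have -> : a = n.+1 by rewrite /n in na *; lia.
    by move/last; case=> //; rewrite /n in na *; lia.
  + by move=> _; rewrite /n in na nb; lia.
Qed.

Lemma is_cube_bool : is_cube 1 (fun x y : bool => x <> y).
Proof.
exists unit, (fun x => [ffun=> x]); split; first by rewrite card_unit.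
  by exists (fun f : {ffun unit -> bool} => f tt) => [x|f]; [rewrite ffunE|apply/ffunP=> -[]; rewrite ffunE].
move=> x y; split=> [xy|[[] /ffunP/(_ tt)]].
  by exists tt; apply/ffunP=> -[]; rewrite !ffunE; case: x y xy => -[].
by rewrite !ffunE /= => ->; case: x.
Qed.

(** [alpha] is quantified inside because the product step uses two splittings of the same cube, for
    [uphalf alpha] and for [alpha./2]. *)
Lemma cube_splitting b :
  exists (V : finType) (E : V -> V -> Prop) (par : V -> bool),
    is_cube (2 ^ b.+1) E /\
    forall alpha, alpha <= 2 ^ b ->
      exists h phi, splitting E par (2 ^ b) alpha (2 ^ b.+2) h phi.
Proof.
elim: b => [|b [V [E [par [cV S]]]]]; last first.
  exists (V * V)%type, (prod_adj E E), (prod_par par); split.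
    by rewrite expnS mul2n -addnn; apply: is_cube_prod.
  move=> alpha ha; have {}ha : alpha <= (2 ^ b).*2 by rewrite -mul2n -expnS.
  have [|h1 [phi1 S1]] := S (uphalf alpha); first by lia.
  have [|h2 [phi2 S2]] := S (alpha./2); first by lia.
  do 2 eexists; rewrite expnS mul2n (expnS 2 b.+2) mul2n.
  by apply: (splitting_prod _ ha S1 S2); rewrite expn_gt0.
exists (bool * bool)%type,
  (prod_adj (fun x y => x <> y) (fun x y => x <> y)), (fun x => x.1 (+) x.2).
split; first exact: is_cube_prod is_cube_bool is_cube_bool.
move=> alpha; rewrite expn0 => ha.
pose h (i : nat) (x : bool * bool) := (~~ x.2, x.1).
(* The square is one 4-cycle: [h] rotates it and the potential numbers its vertices from 0 to 3. *)
exists h, (fun _ (x : bool * bool) => if x.1 then 1 + x.2 else 3 * x.2).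
split.
- by move=> i _ [x1 x2] [y1 y2] [/negb_inj -> ->].
- move=> [x1 x2] [y1 y2]; rewrite /prod_adj /h /=; split.
    by case: x1 x2 y1 y2 => -[] [] [] [] [] //; exists 0 => //; auto.
  by case=> i _ [] [-> ->]; case: x1 x2 y1 y2 => -[] [] []; auto.
- by move=> [|i] [|j].
- by move=> i j [[] []].
- by move=> i [[] []].
- by move=> i [[] []].
- by case: alpha ha => [|[|]] // _ [[] []] [|[|a]] [|[|b]].
Qed.

(** * Paths of length a power of two *)

Lemma path_decompU (V : finType) (O1 O2 : V -> V -> Prop) m :
  (forall x y, O1 x y -> ~ O2 x y) ->
  path_decomp O1 m -> path_decomp O2 m ->
  path_decomp (fun x y => O1 x y \/ O2 x y) m.
Proof.
move=> disj [I [D [p [p1 p2 p3 p4]]]] [J [C [q [q1 q2 q3 q4]]]].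
exists (I + J)%type,
  (fun s => match s with inl i => D i | inr j => C j end),
  (fun s => match s with inl i => p i | inr j => q j end); split.
- by move=> [i|j] a Di am; [left; apply: p1|right; apply: q1].
- by move=> [i|j] a b; [apply: p2|apply: q2].
- move=> x y []; first by move/p3=> [i [a]]; exists (inl i), a.
  by move/q3=> [j [a]]; exists (inr j), a.
- move=> [i|i] [j|j] a b Di Dj am bm e1 e2.
  + by congr inl; apply: p4 e1 e2.
  + by case: (disj _ _ (p1 _ _ Di am)); rewrite e1 e2; apply: q1.
  + by case: (disj _ _ (p1 _ _ Dj bm)); rewrite -e1 -e2; apply: q1.
  + by congr inr; apply: q4 e1 e2.
Qed.

(** Cycles are cut where the potential is divisible by [m]. Working modulo [m.*2] ensures that a
    piece of length [m] does not close up. *)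
Lemma path_decomp_cycles (W K : finType) (g : K -> W -> W) (D : K -> W -> bool)
    (phi : K -> W -> nat) m :
  0 < m -> (forall k, injective (g k)) ->
  (forall k w, D k (g k w) = D k w) ->
  (forall k w, D k w -> phi k (g k w) = (phi k w).+1 %[mod m.*2]) ->
  (forall k l w, D k w -> D l w -> g k w = g l w -> k = l) ->
  path_decomp (fun w w' => exists2 k, D k w & w' = g k w) m.
Proof.
move=> m0 gI gD gphi gK.
have iterD k w a : D k (iter a (g k) w) = D k w.
  by elim: a => //= a <-; apply: gD.
have iterI k a : injective (iter a (g k)).
  by elim: a => [|a IH] x y //= /gI; apply: IH.
have iter_phi k w a : D k w ->
    phi k (iter a (g k) w) = phi k w + a %[mod m.*2].
  move=> Dw; elim: a => [|a IH]; first by rewrite addn0.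
  by rewrite /= gphi ?iterD // -addn1 -modnDml IH modnDml -addnA addn1.
have modm u v : u = v %[mod m.*2] -> u = v %[mod m].
  by move=> e; rewrite -(modn_dvdm u (dvdn_mull 2 (dvdnn m))) mul2n e -mul2n modn_dvdm ?dvdn_mull.
exists (K * W)%type, (fun s => D s.1 s.2 && (m %| phi s.1 s.2)),
  (fun s a => iter a (g s.1) s.2); split.
- move=> [k w] a /= /andP[Dw _] am; exists k => //; by rewrite iterD.
- move=> [k w] a b /= /andP[Dw _] am bm /(congr1 (phi k)) e.
  have /eqP : phi k w + a = phi k w + b %[mod m.*2] by rewrite -!iter_phi // e.
  by rewrite eqn_modDl !modn_small ?(eqP) //; [move/eqP|lia|lia].
- move=> w _ [k Dw ->].
  (* The piece containing the arc out of [w] starts [phi k w %% m] steps before [w]. *)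
  have [f fK Kf] := injF_bij (iterI k (phi k w %% m)).
  have Df : D k (f w) by rewrite -(iterD _ _ (phi k w %% m)) Kf.
  exists (k, f w), (phi k w %% m); rewrite /= Kf ltn_mod m0 Df; split=> //=.
  have /modm := iter_phi k (f w) (phi k w %% m) Df; rewrite Kf => e.
  have /eqP : phi k (f w) + phi k w %% m = 0 + phi k w %% m %[mod m].
    by rewrite -e add0n modn_mod.
  by rewrite eqn_modDr mod0n.
- move=> [k w] [l w'] a b /= /andP[Dw mw] /andP[Dw' mw'] am bm e1 e2.
  have kl : k = l.
    apply: (gK _ _ (iter a (g k) w)); rewrite ?iterD // e1 ?iterD //.
    by rewrite -e2 e1.
  subst l; have ab : a = b.
    have := congr1 (phi k) e1 => /(congr1 (modn^~ m.*2)).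
    rewrite !iter_phi // => /modm/eqP.
    rewrite -!(modnDml (phi k _)) (eqP mw) (eqP mw') !add0n.
    by rewrite !modn_small // => /eqP.
  by rewrite ab in e1; rewrite (iterI _ _ _ _ e1).
Qed.

(** * Sweeps from a vertex [x] to its antipode [sweep x s] *)

Definition sweep (s : nat) (x : {ffun 'I_s -> bool}) (a : nat) :
  {ffun 'I_s -> bool} := [ffun i : 'I_s => (i < a) (+) x i].

Lemma sweep0 s (x : {ffun 'I_s -> bool}) : sweep x 0 = x.
Proof. by apply/ffunP=> i; rewrite ffunE. Qed.

Lemma sweepS s (x : {ffun 'I_s -> bool}) (i : 'I_s) :
  sweep x i.+1 = flip i (sweep x i).
Proof.
apply/ffunP=> j; rewrite !ffunE ltnS leq_eqVlt addbA -val_eqE.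
by case: ltngtP.
Qed.

Lemma sweepK s a : involutive (fun x : {ffun 'I_s -> bool} => sweep x a).
Proof. by move=> x; apply/ffunP=> i; rewrite !ffunE addbA addbb. Qed.

Lemma sweep_path s (x : {ffun 'I_s -> bool}) a b :
  a <= s -> b <= s -> sweep x a = sweep x b -> a = b.
Proof.
wlog ab : a b / a < b => [hw as_ bs e|].
  have [ab|ba|//] := ltngtP a b; first exact: hw.
  by apply/esym/hw.
move=> _ bs /ffunP/(_ (Ordinal (leq_trans ab bs))).
by rewrite !ffunE /= ltnn ab; case: (x _).
Qed.

Lemma sweep_arc s (x y : {ffun 'I_s -> bool}) a b : a < s -> b < s ->
  sweep x a = sweep y b -> sweep x a.+1 = sweep y b.+1 -> a = b /\ x = y.
Proof.
move=> as_ bs e1; rewrite -[a]/(val (Ordinal as_)) -[b]/(val (Ordinal bs)).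
rewrite !sweepS /= e1 => /flip_inj2 [ab]; split=> //.
by rewrite ab in e1; apply: (can_inj (sweepK b)).
Qed.

Lemma sweep_adj s (x y : {ffun 'I_s -> bool}) : cube_adj x y <->
  exists z a, [/\ a < s, x = sweep z a & y = sweep z a.+1].
Proof.
split=> [[i ->]|[z [a [as_ -> ->]]]].
  by exists (sweep x i), i; rewrite sweepS !sweepK ltn_ord.
by exists (Ordinal as_); rewrite -sweepS.
Qed.

Lemma parity_sweep s (x : {ffun 'I_s -> bool}) a :
  a <= s -> parity (sweep x a) = odd a (+) parity x.
Proof.
elim: a => [|a IH] as_; first by rewrite sweep0.
rewrite -[a]/(val (Ordinal as_)) sweepS parity_flip /= IH ?addNb //.
exact: ltnW.
Qed.

(** The flipped coordinate forces [a = b], and one extra flip separates the parities. Hence the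
    sweeps from even vertices use each edge in one direction only. *)
Lemma sweep_rev s (x y : {ffun 'I_s -> bool}) a b : a < s -> b < s ->
  sweep x a = sweep y b.+1 -> sweep x a.+1 = sweep y b -> parity x <> parity y.
Proof.
move=> as_ bs e1 e2.
have e : sweep x a.+1 = flip (Ordinal bs) (sweep x a).
  by rewrite e1 e2 -[b.+1]/((val (Ordinal bs)).+1) sweepS flipK.
move: e; rewrite -[a.+1]/((val (Ordinal as_)).+1) sweepS => /flip_inj2 [ab].
have := congr1 (@parity _) e1; rewrite !parity_sweep ?(ltnW as_) //= ab.
by case: odd; case: parity; case: parity.
Qed.

(** * The product of an odd-dimensional cube with a split cube *)

Lemma follow_inj (V : finType) (E : V -> V -> Prop) par c alpha L h phi a :
  splitting E par c alpha L h phi -> a <= c -> injective (follow h a).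
Proof.
move=> S; elim: a => [|a IH] ac x y //=.
by move/(split_inj S ac)/IH; apply; apply: ltnW.
Qed.

(** The arcs of the paths [main_path]; the [h1] arcs are reversed because the prefix is traced
    backwards. *)
Definition main_arc (V : finType) (r alpha1 alpha2 : nat)
    (h1 h2 : nat -> V -> V) (w w' : {ffun 'I_r -> bool} * V) : Prop :=
  [\/ [/\ ~~ parity w.1, w.1 = w'.1 & exists2 i, i < alpha1 & w.2 = h1 i w'.2],
      exists z a, [/\ ~~ parity z, a < r,
        w = (sweep z a, w.2) & w' = (sweep z a.+1, w.2)]
    | [/\ parity w.1, w.1 = w'.1 & exists2 i, i < alpha2 & w'.2 = h2 i w.2]].

(* The path through [(z, y)], with [z] even: the [h1]-path from [y] traced
   backwards, then the sweep from [z] to its antipode, then the [h2]-path. *)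
Definition main_path (V : Type) (r alpha1 : nat) (h1 h2 : nat -> V -> V)
    (s : {ffun 'I_r -> bool} * V) (a : nat) : {ffun 'I_r -> bool} * V :=
  (sweep s.1 (minn r (a - alpha1)),
   if a < alpha1 then follow h1 (alpha1 - a) s.2
   else follow h2 (a - alpha1 - r) s.2).

(** Since [r] is odd, prefixes lie over even and suffixes over odd vertices of Q_r. Each [follow] is
    a bijection, so every arc of a path factor is met once. *)
Lemma path_decomp_main (V : finType) (E : V -> V -> Prop) par c L r
    alpha1 h1 phi1 alpha2 h2 phi2 :
  odd r -> alpha1 <= c -> alpha2 <= c ->
  splitting E par c alpha1 L h1 phi1 -> splitting E par c alpha2 L h2 phi2 ->
  path_decomp (@main_arc V r alpha1 alpha2 h1 h2) (alpha1 + r + alpha2).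
Proof.
move=> ro ac1 ac2 S1 S2.
set p := @main_path V r alpha1 h1 h2.
have r0 : 0 < r by case: (r) ro.
have P1 s k : k <= alpha1 -> p s (alpha1 - k) = (s.1, follow h1 k s.2).
  move=> ka; rewrite /p /main_path.
  have -> : minn r (alpha1 - k - alpha1) = 0 by lia.
  rewrite sweep0; case: ltnP => h; first by congr (_, follow _ _ _); lia.
  have -> : k = 0 by lia.
  by have -> : alpha1 - 0 - alpha1 - r = 0 by lia.
have P2 s k : k <= r -> p s (alpha1 + k) = (sweep s.1 k, s.2).
  move=> kr; rewrite /p /main_path.
  have -> : minn r (alpha1 + k - alpha1) = k by lia.
  rewrite ltnNge leq_addr /=.
  by have -> : alpha1 + k - alpha1 - r = 0 by lia.
have P3 s k : p s (alpha1 + r + k) = (sweep s.1 r, follow h2 k s.2).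
  rewrite /p /main_path.
  have -> : minn r (alpha1 + r + k - alpha1) = r by lia.
  rewrite ltnNge -addnA leq_addr /=.
  by have -> : alpha1 + (r + k) - alpha1 - r = k by lia.
have region a : a < alpha1 + r + alpha2 ->
    [\/ exists2 k, k < alpha1 & [/\ k <= alpha1, a = alpha1 - k.+1 & a.+1 = alpha1 - k],
        exists2 k, k < r & k <= r /\ a = alpha1 + k
      | exists2 k, k < alpha2 & a = alpha1 + r + k].
  move=> am; have [h|h] := ltnP a alpha1.
    by constructor 1; exists (alpha1 - a.+1); [|split]; lia.
  have [h'|h'] := ltnP a (alpha1 + r).
    by constructor 2; exists (a - alpha1); lia.
  by constructor 3; exists (a - (alpha1 + r)); lia.
have nsweep (z z' : {ffun 'I_r -> bool}) k : k < r ->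
    z = sweep z' k -> z = sweep z' k.+1 -> False.
  move=> kr -> /sweep_path; move=> /(_ (ltnW kr) kr) e; lia.
have podd (z z' : {ffun 'I_r -> bool}) :
    ~~ parity z -> ~~ parity z' -> z = sweep z' r -> False.
  by move=> zo zo' e; move: zo; rewrite e parity_sweep // ro; case: parity zo'.
exists ({ffun 'I_r -> bool} * V)%type, (fun s => ~~ parity s.1), p; split.
- move=> s a so /region[[k ka [ka' -> ->]]|[k kr [kr' ->]]|[k ka ->]].
  + rewrite !P1 //.
    by constructor 1; split=> //; exists k.
  + rewrite -addnS !P2 //.
    by constructor 2; exists s.1, k.
  + rewrite -addnS !P3; constructor 3; split=> //; last by exists k.
    by rewrite parity_sweep // ro.
- move=> s a b so am bm e.
  have := congr1 fst e => /sweep_path t; have {}t := t (geq_minl _ _) (geq_minl _ _).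
  move/(congr1 snd): e => /=.
  have [h|h] := ltnP a alpha1; have [h'|h'] := ltnP b alpha1.
  + move/(split_path S1) => e.
    by have := e (leq_subr _ _) (leq_subr _ _); lia.
  + have [-> h0] : b = alpha1 /\ alpha1 - alpha1 - r = 0 by lia.
    rewrite h0 => /(@split_path _ _ _ _ _ _ _ _ S1 _ _ 0) e.
    by have := e (leq_subr _ _) isT; lia.
  + have [-> h0] : a = alpha1 /\ alpha1 - alpha1 - r = 0 by lia.
    rewrite h0 => /esym/(@split_path _ _ _ _ _ _ _ _ S1 _ _ 0) e.
    by have := e (leq_subr _ _) isT; lia.
  + move/(split_path S2) => e.
    suff : a - alpha1 - r = b - alpha1 - r by lia.
    by apply: e; lia.
- move=> [x v] [x' v'] [[/= xo <- [i ia ->]]|[z [a [zo ar [-> ->]]]]|].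
  (* The path through this arc has as its [y] the preimage of [v'] under [follow h1 i]. *)
  + have [f fK Kf] := injF_bij (follow_inj S1 (ltnW (leq_trans ia ac1))).
    exists (x, f v'), (alpha1 - i.+1); split=> //=; first by lia.
      by rewrite P1 //= Kf.
    have -> : (alpha1 - i.+1).+1 = alpha1 - i by lia.
    by rewrite P1 ?(ltnW ia) //= Kf.
  + exists (z, v), (alpha1 + a); split=> //=; first by lia.
      by rewrite P2 // ltnW.
    by rewrite -addnS P2.
  + move=> /= [xo <- [i ia ->]].
    have [f fK Kf] := injF_bij (follow_inj S2 (ltnW (leq_trans ia ac2))).
    exists (sweep x r, f v), (alpha1 + r + i); split=> /=.
    * by rewrite parity_sweep // ro xo.
    * by lia.
    * by rewrite P3 /= sweepK Kf.
    * by rewrite -addnS P3 /= sweepK Kf.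
- move=> [z y] [z' y'] a b /= zo zo' am bm.
  (* Arcs from different phases differ: only sweep arcs change the first component ([nsweep]), and
     prefixes and suffixes lie over different parities ([podd]). *)
  case: (region a am) => [[k ka [ka' -> ->]]|[k kr [kr' ->]]|[k ka ->]];
  case: (region b bm) => [[l la [la' -> ->]]|[l lr [lr' ->]]|[l la ->]];
  rewrite -?[(alpha1 + _).+1]addnS -?[(alpha1 + _ + _).+1]addnS
    ?P1 ?P2 ?P3 //= => -[e1 f1] [e2 f2].
  + rewrite f2 in f1; have kl : k = l.
      by apply: (split_eq S1) f1; [apply: leq_trans ac1|apply: leq_trans ac1].
    move: f2; rewrite kl e1 => /(follow_inj S1) ->//.
    exact: ltnW (leq_trans la ac1).
  + by case: (nsweep _ _ _ lr e1 e2).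
  + by case: (podd _ _ zo zo' e1).
  + by case: (nsweep _ _ _ kr (esym e1) (esym e2)).
  + by have [_ ->] := sweep_arc kr lr e1 e2; rewrite f1.
  + by case: (nsweep _ _ _ kr (esym e1) (esym e2)).
  + by case: (podd _ _ zo' zo (esym e1)).
  + by case: (nsweep _ _ _ lr e1 e2).
  + rewrite f1 in f2; have kl : k = l.
      by apply: (split_eq S2) f2; [apply: leq_trans ac2|apply: leq_trans ac2].
    move: f1; rewrite kl (can_inj (@sweepK _ _) e1) => /(follow_inj S2) ->//.
    exact: ltnW (leq_trans la ac2).
Qed.

Lemma cube_adj_sym (I : finType) (x y : {ffun I -> bool}) :
  cube_adj x y -> cube_adj y x.
Proof. by case=> i ->; exists i; rewrite flipK. Qed.

(** The splitting with [h1] is used over even vertices of Q_r and the one with [h2] over odd ones;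
    factors not consumed by the main paths go to [path_decomp_cycles]. *)
Lemma path_divides_prod (V : finType) (E : V -> V -> Prop) par c r m
    alpha1 h1 phi1 alpha2 h2 phi2 :
  odd r -> alpha1 <= c -> alpha2 <= c -> alpha1 + r + alpha2 = m ->
  splitting E par c alpha1 m.*2 h1 phi1 ->
  splitting E par c alpha2 m.*2 h2 phi2 ->
  path_divides (prod_adj (@cube_adj 'I_r) E) m.
Proof.
move=> ro ac1 ac2 mE S1 S2.
pose h (x : {ffun 'I_r -> bool}) := if parity x then h2 else h1.
pose D (k : 'I_c) (w : {ffun 'I_r -> bool} * V) :=
  (if parity w.1 then alpha2 else alpha1) <= k.
pose g (k : 'I_c) (w : {ffun 'I_r -> bool} * V) := (w.1, h w.1 k w.2).
pose phi (k : 'I_c) (w : {ffun 'I_r -> bool} * V) :=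
  if parity w.1 then phi2 k w.2 else phi1 k w.2.
pose Om := @main_arc V r alpha1 alpha2 h1 h2.
pose Oc w w' := exists2 k, D k w & w' = g k w.
pose O w w' := Om w w' \/ Oc w w'.
have Esym x y : E x y -> E y x.
  by case/(split_adj S1)=> i ic h'; apply/(split_adj S1); exists i => //; case: h'; auto.
have sweep_neq (z : {ffun 'I_r -> bool}) a : a < r -> sweep z a <> sweep z a.+1.
  by move=> ar /sweep_path e; have := e (ltnW ar) ar; lia.
have vert x y y' : O (x, y) (x, y') -> exists2 k, k < c &
    if parity x then y' = h2 k y
    else if k < alpha1 then y = h1 k y' else y' = h1 k y.
  case=> [[[/= xo _ [i ia ->]]|[z [a [_ ar [e] [e' _]]]]|[/= xo _ [i ia ->]]]|].
  + by exists i; [apply: leq_trans ac1|rewrite (negPf xo) ia].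
  + by have /(_ (etrans (esym e) e')) := sweep_neq z a ar.
  + by exists i; [apply: leq_trans ac2|rewrite xo].
  case=> k; rewrite /D /g /h /= => Dk -[->]; exists k => //; move: Dk.
  by case: (parity x) => //; rewrite ltnNge => ->.
have horiz x y x' y' : O (x, y) (x', y') -> x <> x' ->
    exists z a, [/\ ~~ parity z, a < r, x = sweep z a & x' = sweep z a.+1].
  case=> [[[/= _ -> //]|[z [a [zo ar [->] [-> _]]]]|[/= _ -> //]]|].
  + by exists z, a.
  + by case=> k _ [->].
exists O.
  split=> [w w'|[x y] [x' y']]; last first.
    (* Inside one copy of [V], opposite arcs contradict [split_rev] or the fixed direction of a
       factor; otherwise both lie on sweeps with even start, against [sweep_rev]. *)
    have [->|/eqP xx'] := eqVneq x x'.
      move=> /vert[k kc e1] /vert[l lc]; move: e1.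
      case: (parity x') => [->|]; first by move/esym; apply: (split_rev S2).
      case: ifP => ka e1; case: ifP => la e2.
      * by move: e1; rewrite e2 => /esym; apply: (split_rev S1).
      * move: ka la; suff -> : k = l by move=> ->.
        exact: (split_eq S1 kc lc (etrans (esym e1) e2)).
      * move: ka la; suff -> : k = l by move=> ->.
        exact: (split_eq S1 kc lc (etrans (esym e1) e2)).
      * by move: e1; rewrite e2 => /esym; apply: (split_rev S1).
    move=> /horiz /(_ xx')[z [a [zo ar e1 e2]]].
    move=> /horiz /(_ (nesym xx'))[z' [b [zo' br e3 e4]]].
    have := sweep_rev ar br (etrans (esym e1) e4) (etrans (esym e2) e3).
    by rewrite (negPf zo) (negPf zo').
  have OE u u' : O u u' -> prod_adj (@cube_adj _) E u u'.
    case=> [[[/= _ e [i ia e']]|[z [a [_ ar -> ->]]]|[/= _ e [i ia e']]]|].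
    + left; split=> //; apply/(split_adj S1); exists i; last by right.
      exact: leq_trans ac1.
    + right; split=> //=; apply/sweep_adj; by exists z, a.
    + left; split=> //; apply/(split_adj S2); exists i; last by left.
      exact: leq_trans ac2.
    case=> k _ ->; left; split=> //=; rewrite /h; case: ifP => _.
      by apply/(split_adj S2); exists k; last by left.
    by apply/(split_adj S1); exists k; last by left.
  split; last first.
    case; [exact: OE|case/OE=> -[e e']; [left|right]; split=> //].
      exact: Esym.
    exact: cube_adj_sym.
  have arc x y k : k < c ->
      O (x, y) (x, h x k y) \/ O (x, h x k y) (x, y).
    move=> kc; case: (leqP (if parity x then alpha2 else alpha1) k) => ka.
      by left; right; exists (Ordinal kc).
    rewrite /h; case: ifP ka => xo ka; first by left; left; constructor 3; split=> //; exists k.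
    by right; left; constructor 1; split; [rewrite /= xo| |exists k].
  case: w w' => [x y] [x' y'] [[/= <- Eyy]|[/= <- [i ->]]].
    have [k kc e] : exists2 k, k < c & y' = h x k y \/ y = h x k y'.
      rewrite /h; case: parity.
        by have [+ _] := split_adj S2 y y'; apply.
      by have [+ _] := split_adj S1 y y'; apply.
    case: e => ->; first exact: arc.
    by case: (arc x y' k kc); [right|left].
  have hor u : ~~ parity (sweep u i) -> O (u, y) (flip i u, y).
    move=> uo; left; constructor 2; exists (sweep u i), i.
    by rewrite sweepS !sweepK.
  (* The sweeps through this edge in its two directions start at [sweep x i] and
     [sweep (flip i x) i], exactly one of which is even. *)
  have [xo|xo] := boolP (parity (sweep x i)); last by left; apply: hor.
  right; rewrite -{2}(flipK i x); apply: hor.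
  have il := ltnW (ltn_ord i).
  by move: xo; rewrite !parity_sweep // parity_flip addbN negbK.
apply: path_decompU.
- move=> [x y] [x' y'] Omw [k]; rewrite /D /g /= => kD [ex ey].
  move: Omw kD ey; rewrite {x'}ex /h.
  case=> [[/= xo _ [i ia ->]]|[z [a [_ ar [e] [e' _]]]]|[/= xo _ [i ia ->]]].
  + rewrite (negPf xo) => _ /esym; apply: (split_rev S1) => //.
    exact: leq_trans ac1.
  + by have /(_ (etrans (esym e) e')) := sweep_neq z a ar.
  + rewrite xo => ka /(split_eq S2 (leq_trans ia ac2) (ltn_ord k)) ik.
    by rewrite ik ltnNge ka in ia.
- by rewrite -mE; apply: path_decomp_main S1 S2.
- have m0 : 0 < m by rewrite -mE; case: (r) ro => // n _; rewrite addnS.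
  apply: (@path_decomp_cycles _ _ g D phi) => //.
  + move=> k [x y] [x' y']; rewrite /g /= => -[<-]; rewrite /h.
    by case: parity; [move/(split_inj S2 (ltn_ord k))|move/(split_inj S1 (ltn_ord k))] => ->.
  + move=> k [x y]; rewrite /D /phi /g /h /=; case: parity => ka.
      by apply: (split_level S2).
    by apply: (split_level S1).
  + move=> k l [x y] _ _ []; rewrite /h; apply: contra_eq => kl.
    apply/eqP; case: parity.
      by move/(split_eq S2 (ltn_ord k) (ltn_ord l))/val_inj/eqP; apply/negP.
    by move/(split_eq S1 (ltn_ord k) (ltn_ord l))/val_inj/eqP; apply/negP.
Qed.

Lemma cube_path_divides_pow b r : odd r -> r < 2 ^ b.+1 ->
  path_divides (@cube_adj 'I_(2 ^ b.+1 + r)) (2 ^ b.+1).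
Proof.
move=> ro rb; have [V [E [par [cV S]]]] := cube_splitting b.
have mE : 2 ^ b.+1 = (2 ^ b).*2 by rewrite expnS mul2n.
(* The length [2 ^ b.+1 - r] left for prefix and suffix is shared greedily, so that neither part
   exceeds [2 ^ b]. *)
pose alpha := minn (2 ^ b) (2 ^ b.+1 - r).
have [|h1 [phi1 S1]] := S alpha; first by rewrite /alpha geq_minl.
have [|h2 [phi2 S2]] := S (2 ^ b.+1 - r - alpha); first by rewrite /alpha; lia.
rewrite [2 ^ b.+2]expnS mul2n in S1 S2.
have cR : is_cube r (@cube_adj 'I_r).
  by exists 'I_r, id; split; [exact: card_ord|exists id|].
rewrite [_ + r]addnC; apply: (path_divides_cube (is_cube_prod cR cV)).
by apply: (path_divides_prod ro _ _ _ S1 S2); rewrite /alpha; lia.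
Qed.

(** * Blowing up coordinates *)

(* The antipodal paths of the odd cube, indexed by their start so that the
   paths from [y] and from its antipode are reverses of each other. *)
Definition zig (d : nat) (y : {ffun 'I_d -> bool}) (a : nat) :
    {ffun 'I_d -> bool} :=
  if parity y then sweep (sweep y d) (d - a) else sweep y a.

Lemma zig0 d (y : {ffun 'I_d -> bool}) : zig y 0 = y.
Proof. by rewrite /zig subn0 sweepK sweep0; case: ifP. Qed.

Lemma zig_end d (y : {ffun 'I_d -> bool}) : zig y d = sweep y d.
Proof. by rewrite /zig subnn sweep0; case: ifP. Qed.

Lemma parity_antipode d (y : {ffun 'I_d -> bool}) :
  odd d -> parity (sweep y d) = ~~ parity y.
Proof. by move=> od; rewrite parity_sweep // od. Qed.

Lemma zig_rev d (y : {ffun 'I_d -> bool}) a :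
  odd d -> a <= d -> zig (sweep y d) a = zig y (d - a).
Proof.
move=> od ad; rewrite /zig parity_antipode // subKn // sweepK.
by case: parity.
Qed.

Lemma zig_path d (y : {ffun 'I_d -> bool}) a b :
  a <= d -> b <= d -> zig y a = zig y b -> a = b.
Proof.
rewrite /zig => ad bd; case: ifP => _ /sweep_path e; last exact: e.
by have := e (leq_subr _ _) (leq_subr _ _); lia.
Qed.

(** A [zig] with even start is a sweep, one with odd start a reversed sweep from an even vertex;
    [sweep_rev] keeps the two kinds apart. *)
Lemma zig_arc d (y z : {ffun 'I_d -> bool}) a b : odd d -> a < d -> b < d ->
  zig y a = zig z b -> zig y a.+1 = zig z b.+1 -> a = b /\ y = z.
Proof.
move=> od ad bd; rewrite /zig.
have ra : d - a = (d - a.+1).+1 by lia.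
have rb : d - b = (d - b.+1).+1 by lia.
have [la lb] : d - a.+1 < d /\ d - b.+1 < d by lia.
case yo: (parity y); case zo: (parity z); rewrite ?ra ?rb => e1 e2.
- have [ab /(can_inj (@sweepK _ _)) yz] := sweep_arc la lb e2 e1.
  by split=> //; lia.
- by have := sweep_rev la bd e2 e1; rewrite parity_antipode // yo zo.
- by have := sweep_rev ad lb e1 e2; rewrite parity_antipode // yo zo.
- exact: sweep_arc.
Qed.

Lemma zig_adj d (x y : {ffun 'I_d -> bool}) : odd d ->
  cube_adj x y <-> exists z a, [/\ a < d, x = zig z a & y = zig z a.+1].
Proof.
move=> od; split=> [[i e]|[z [a [ad -> ->]]]]; last first.
  rewrite /zig; case: ifP => _; last by apply/sweep_adj; exists z, a.
  apply: cube_adj_sym; apply/sweep_adj; exists (sweep z d), (d - a.+1).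
  have -> : (d - a.+1).+1 = d - a by lia.
  by split=> //; lia.
have il := ltn_ord i; have ex : x = flip i y by rewrite e flipK.
have even_arc u v : v = flip i u -> ~~ parity (sweep u i) ->
    u = zig (sweep u i) i /\ v = zig (sweep u i) i.+1.
  by move=> -> ev; rewrite /zig (negPf ev) sweepS !sweepK.
have [xo|xo] := boolP (parity (sweep x i)); last first.
  by have [e1 e2] := even_arc _ _ e xo; exists (sweep x i), i.
have yo : ~~ parity (sweep y i).
  move: xo; rewrite ex !parity_sweep ?(ltnW il) // parity_flip.
  by rewrite addbN.
have [e1 e2] := even_arc _ _ ex yo.
exists (sweep (sweep y i) d), (d - i.+1); split; first by lia.
  by rewrite zig_rev ?subKn //; lia.
have -> : (d - i.+1).+1 = d - i by lia.
by rewrite zig_rev ?subKn //; lia.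
Qed.

(** For odd [d] and even [y], the bit [s] is the parity of the result. *)
Definition comb (d : nat) (s : bool) (y : {ffun 'I_d -> bool}) :
  {ffun 'I_d -> bool} := if s then sweep y d else y.

Lemma comb_inj d s t (y z : {ffun 'I_d -> bool}) : odd d ->
  ~~ parity y -> ~~ parity z -> comb s y = comb t z -> s = t /\ y = z.
Proof.
move=> od yo zo; rewrite /comb; case: s; case: t => e; split=> //.
- exact: (can_inj (@sweepK _ _) e).
- by move: zo; rewrite -e parity_antipode // yo.
- by move: zo; rewrite -e parity_antipode // yo.
- by move: yo; rewrite e parity_antipode // zo.
- by move: yo; rewrite e parity_antipode // zo.
Qed.

(** Both [y] and its antipode are ends of the path, which visits no vertex twice. *)
Lemma zig_comb d s t (y : {ffun 'I_d -> bool}) b :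
  b <= d -> zig (comb s y) b = comb t y -> b = 0 \/ b = d.
Proof.
move=> bd e; have [st|st] := eqVneq s t.
  by left; apply: (@zig_path d (comb s y) _ _ bd (leq0n d)); rewrite e zig0 st.
right; apply: (@zig_path d (comb s y) _ _ bd (leqnn d)); rewrite e zig_end /comb.
by case: s t st {e} => -[] //=; rewrite sweepK.
Qed.

Lemma comb_negb d s (y : {ffun 'I_d -> bool}) :
  comb (~~ s) y = sweep (comb s y) d.
Proof. by case: s; rewrite /comb //= sweepK. Qed.

(* Vertices of the cube of dimension [k * d], as functions from ['I_k] to the
   cube of dimension [d].  For even [w], a vertex [u] of the [k]-cube selects
   in each block [w j] or its antipode; the state below is position [t] on the
   antipodal path in block [c] that replaces the edge of direction [c] at [u]. *)
Definition state (k d : nat) (c : 'I_k) (u : {ffun 'I_k -> bool})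
    (w : {ffun 'I_k -> {ffun 'I_d -> bool}}) (t : nat) :
    {ffun 'I_k -> {ffun 'I_d -> bool}} :=
  [ffun j => if j == c then zig (comb (u j) (w j)) t else comb (u j) (w j)].

Definition even_blocks (k d : nat) (w : {ffun 'I_k -> {ffun 'I_d -> bool}}) :=
  [forall j, ~~ parity (w j)].

Definition block_adj (k d : nat) (x y : {ffun 'I_k -> {ffun 'I_d -> bool}}) :
  Prop := exists c, cube_adj (x c) (y c) /\ forall j, j != c -> x j = y j.

Lemma is_cube_block k d : is_cube (k * d) (@block_adj k d).
Proof.
pose f (x : {ffun 'I_k -> {ffun 'I_d -> bool}}) : {ffun 'I_k * 'I_d -> bool} :=
  [ffun s => x s.1 s.2].
pose f' (x : {ffun 'I_k * 'I_d -> bool}) : {ffun 'I_k -> {ffun 'I_d -> bool}} :=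
  [ffun i => [ffun j => x (i, j)]].
have fK : cancel f f'.
  by move=> x; apply/ffunP=> i; apply/ffunP=> j; rewrite !ffunE.
have Kf : cancel f' f by move=> x; apply/ffunP=> -[i j]; rewrite !ffunE.
exists ('I_k * 'I_d)%type, f; split; first by rewrite card_prod !card_ord.
  by exists f'.
move=> x y; split=> [[c [[i e] e']]|[[c i] /ffunP e]].
  exists (c, i); apply/ffunP=> -[j l]; rewrite !ffunE /= xpair_eqE.
  have [->|jc] := eqVneq j c; first by rewrite e ffunE.
  by rewrite (e' _ jc).
exists c; split=> [|j jc]; first exists i; apply/ffunP=> l.
  by have := e (c, l); rewrite !ffunE /= xpair_eqE eqxx.
by have := e (j, l); rewrite !ffunE /= xpair_eqE (negPf jc).
Qed.

Lemma state0 k d c u (w : {ffun 'I_k -> {ffun 'I_d -> bool}}) :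
  state c u w 0 = [ffun j => comb (u j) (w j)].
Proof. by apply/ffunP=> j; rewrite !ffunE zig0 if_same. Qed.

(** The two directions of an edge of the [k]-cube thus give the two directions of one path. *)
Lemma state_rev k d c u (w : {ffun 'I_k -> {ffun 'I_d -> bool}}) t : odd d ->
  t <= d -> state c (flip c u) w (d - t) = state c u w t.
Proof.
move=> od td; apply/ffunP=> j; rewrite !ffunE; case: eqVneq => // _ /=.
by rewrite comb_negb zig_rev ?subKn ?leq_subr.
Qed.

Lemma state_end k d c u (w : {ffun 'I_k -> {ffun 'I_d -> bool}}) : odd d ->
  state c u w d = [ffun j => comb (flip c u j) (w j)].
Proof. by move=> od; rewrite -state_rev // subnn state0. Qed.

(** The block that changes is [c]; there [zig_arc] yields [t], and [comb_inj] then recovers [u] and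
    [w] blockwise. *)
Lemma state_arc k d c c' u u' (w w' : {ffun 'I_k -> {ffun 'I_d -> bool}}) t t' :
  odd d -> even_blocks w -> even_blocks w' -> t < d -> t' < d ->
  state c u w t = state c' u' w' t' -> state c u w t.+1 = state c' u' w' t'.+1 ->
  [/\ c = c', u = u', w = w' & t = t'].
Proof.
move=> od /forallP ew /forallP ew' td td' /ffunP e1 /ffunP e2.
have cc : c = c'.
  apply/eqP; apply: contraT => ne; move: (e1 c) (e2 c).
  rewrite !ffunE eqxx (negPf ne) => <- /esym /zig_path e.
  by have := e (ltnW td) td; lia.
subst c'; move: (e1 c) (e2 c); rewrite !ffunE eqxx => f1 f2.
have [tt fc] := zig_arc od td td' f1 f2.
have uw j : u j = u' j /\ w j = w' j.
  apply: (comb_inj od (ew j) (ew' j)).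
  by have := e1 j; rewrite !ffunE; case: eqVneq => // ->.
by split=> //; apply/ffunP=> j; have [] := uw j.
Qed.

Lemma path_divides_odd_mul k d m : odd d ->
  path_divides (@cube_adj 'I_k) m -> path_divides (@cube_adj 'I_(k * d)) (m * d).
Proof.
move=> od [O [EO asym] [I [D [p [p1 p2 p3 p4]]]]].
apply: (path_divides_cube (is_cube_block k d)).
have d0 : 0 < d by case: (d) od.
pose st := @state k d.
pose O' x y := exists c u w t, [/\ even_blocks w, O u (flip c u), t < d,
  x = st c u w t & y = st c u w t.+1].
have rev c u w t : t < d -> st c (flip c u) w (d - t.+1) = st c u w t.+1 /\
    st c (flip c u) w (d - t.+1).+1 = st c u w t.
  move=> td; split; first exact: state_rev.
  have -> : (d - t.+1).+1 = d - t by lia.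
  by apply: state_rev => //; apply: ltnW.
exists O'.
  split=> x y; last first.
    move=> [c [u [w [t [ew Ou td -> ->]]]]].
    move=> [c' [u' [w' [t' [ew' Ou' td' e1 e2]]]]].
    have [r1 r2] := rev c' u' w' _ td'.
    have rd : d - t'.+1 < d by lia.
    have [cc uu _ _] := state_arc od ew ew' td rd
      (etrans e2 (esym r1)) (etrans e1 (esym r2)).
    by apply: asym Ou' _; move: Ou; rewrite cc uu flipK.
  have blockC x' y' : @block_adj k d x' y' -> block_adj y' x'.
    by case=> c [e e']; exists c; split=> [|j /e' ->//]; apply: cube_adj_sym.
  have O'E x' y' : O' x' y' -> @block_adj k d x' y'.
    move=> [c [u [w [t [ew Ou td -> ->]]]]]; exists c; split.
      by rewrite !ffunE eqxx; apply/zig_adj => //; eexists; exists t.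
    by move=> j jc; rewrite !ffunE (negPf jc).
  split; last by case=> /O'E //; apply: blockC.
  case=> c [/(zig_adj _ _ od) [z [t [td ez ez']]] xy].
  (* Block [c] is moved back to the start of its antipodal path; then parities give [u] and even
     representatives give [w]. *)
  pose v j := if j == c then z else x j.
  pose u : {ffun 'I_k -> bool} := [ffun j => parity (v j)].
  pose w : {ffun 'I_k -> {ffun 'I_d -> bool}} :=
    [ffun j => comb (parity (v j)) (v j)].
  have uw j : comb (u j) (w j) = v j.
    by rewrite !ffunE /comb; case: (parity (v j)) => //; rewrite sweepK.
  have ew : even_blocks w.
    apply/forallP=> j; rewrite ffunE /comb.
    by case: ifP => [yo|->//]; rewrite parity_antipode // yo.
  have ex : x = st c u w t.
    apply/ffunP=> j; rewrite ffunE uw /v.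
    by case: eqVneq => [->|//]; exact: ez.
  have ey : y = st c u w t.+1.
    apply/ffunP=> j; rewrite ffunE uw /v.
    by case: eqVneq => [->|/xy ->//]; exact: ez'.
  have /EO[Ou|Ou] : cube_adj u (flip c u) by exists c.
    by left; exists c, u, w, t.
  right; exists c, (flip c u), w, (d - t.+1); rewrite flipK.
  by have [-> ->] := rev c u w t td; split=> //; lia.
(* At [A = m * d] this reads [p s.1 m.+1], beyond the end of the path; since [A %% d = 0] there,
   both branches agree by [zig0]. *)
pose q (s : I * {ffun 'I_k -> {ffun 'I_d -> bool}}) A :
    {ffun 'I_k -> {ffun 'I_d -> bool}} :=
  [ffun j => if p s.1 (A %/ d) j == p s.1 (A %/ d).+1 j
             then comb (p s.1 (A %/ d) j) (s.2 j)
             else zig (comb (p s.1 (A %/ d) j) (s.2 j)) (A %% d)].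
have edge i a : D i -> a < m -> exists c, p i a.+1 = flip c (p i a).
  move=> Di am; suff : cube_adj (p i a) (p i a.+1) by [].
  by apply/EO; left; apply: p1.
have q_full s a : q s (a * d) = [ffun j => comb (p s.1 a j) (s.2 j)].
  by apply/ffunP=> j; rewrite !ffunE mulnK // modnMl zig0 if_same.
have q_state s a b c : p s.1 a.+1 = flip c (p s.1 a) -> b <= d ->
    q s (a * d + b) = st c (p s.1 a) s.2 b.
  move=> e; rewrite leq_eqVlt => /orP[/eqP ->|bd].
    by rewrite addnC -mulSn q_full /st state_end // e.
  apply/ffunP=> j; rewrite !ffunE divnMDl // divn_small // addn0.
  rewrite modnMDl modn_small // e ffunE.
  by case: (eqVneq j c) => [->|_]; case: (p s.1 a _).
have not_full c u (w : {ffun 'I_k -> {ffun 'I_d -> bool}}) b t :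
    b < d -> st c u w b c = comb t (w c) -> b = 0.
  move=> bd; rewrite ffunE eqxx => /(zig_comb (ltnW bd)) [] // e.
  by rewrite e ltnn in bd.
exists (I * {ffun 'I_k -> {ffun 'I_d -> bool}})%type,
  (fun s => D s.1 && even_blocks s.2), q; split.
- move=> [i w] A /= /andP[Di ew] Am.
  have am : A %/ d < m by rewrite ltn_divLR.
  have bd : A %% d < d by rewrite ltn_mod.
  have [c e] := edge i _ Di am.
  exists c, (p i (A %/ d)), w, (A %% d); rewrite -e; split=> //.
  + exact: p1.
  + by rewrite {1}(divn_eq A d) (q_state (i, w) _ _ _ e) // ltnW.
  + by rewrite {1}(divn_eq A d) -addnS (q_state (i, w) _ _ _ e).
- move=> [i w] A B /= /andP[Di ew] Am Bm.
  have evw := forallP ew.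
  have position C : C <= m * d -> (exists2 a, a <= m & C = a * d) \/
      exists a b, [/\ a < m, 0 < b, b < d & C = a * d + b].
    move=> Cm; have := divn_eq C d; case: (posnP (C %% d)) => [->|Cd] e.
      left; exists (C %/ d); last by rewrite {1}e addn0.
      by rewrite -(leq_pmul2r d0); apply: leq_trans Cm; apply: leq_divM.
    right; exists (C %/ d), (C %% d); rewrite ltn_mod; split=> //.
    rewrite ltn_divLR // ltn_neqAle Cm andbT.
    by apply: contraTneq Cd => ->; rewrite modnMl.
  have neq a a' b : a' < m -> 0 < b -> b < d ->
      q (i, w) (a * d) <> q (i, w) (a' * d + b).
    move=> am b0 bd; have [c e] := edge i _ Di am.
    rewrite q_full (q_state (i, w) _ _ _ e) ?(ltnW bd) // => /ffunP/(_ c).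
    by rewrite [LHS]ffunE => /esym/(not_full _ _ _ _ _ bd) b_0; rewrite b_0 in b0.
  case: (position A Am) => [[a am ->]|[a [b [am b0 bd ->]]]];
  case: (position B Bm) => [[a' am' ->]|[a' [b' [am' b0' bd' ->]]]].
  + rewrite !q_full => /ffunP e; congr (_ * d); apply: (p2 i) => //.
    apply/ffunP=> j; have := e j; rewrite !ffunE.
    by case/(comb_inj od (evw j) (evw j)).
  + by move/neq; case.
  + by move/esym/neq; case.
  have [c e] := edge i _ Di am; have [c' e'] := edge i _ Di am'.
  rewrite (q_state (i, w) _ _ _ e) ?(ltnW bd) //.
  rewrite (q_state (i, w) _ _ _ e') ?(ltnW bd') //= => /ffunP es.
  have cc : c = c'.
    apply/eqP; apply: contraT => ne; have := es c.
    rewrite [RHS]ffunE (negPf ne) => /(not_full _ _ _ _ _ bd) b_0.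
    by rewrite b_0 in b0.
  subst c'; have [ec|ec] := eqVneq (p i a c) (p i a' c).
    have aa : a = a'.
      apply: (p2 i) => //; [exact: ltnW|exact: ltnW|apply/ffunP=> j].
      have := es j; rewrite !ffunE; case: eqVneq => [-> _ //|_].
      by case/(comb_inj od (evw j) (evw j)).
    congr (_ * d + _) => //.
    have := es c; rewrite !ffunE eqxx aa.
    by apply: zig_path; apply: ltnW.
  (* Here steps [a] and [a'] would traverse the same edge in opposite directions, forcing both
     [a' = a.+1] and [a'.+1 = a]. *)
  have pa : p i a' = p i a.+1.
    rewrite e; apply/ffunP=> j; have := es j; rewrite !ffunE.
    case: eqVneq => [-> _|_]; first by case: (p i a c) ec; case: (p i a' c).
    by case/(comb_inj od (evw j) (evw j)) => ->.
  have a1 : a' = a.+1 by apply: (p2 i) pa => //; apply: ltnW.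
  have : a'.+1 = a.
    by apply: (p2 i) => //; [exact: ltnW|rewrite e' pa e flipK].
  by rewrite a1; lia.
- move=> x y [c [u [w [t [ew Ou td -> ->]]]]].
  have [i [a [Di am e e']]] := p3 _ _ Ou.
  rewrite -e in e' *; exists (i, w), (a * d + t); split.
  + by rewrite /= Di.
  + by move: am; rewrite -(leq_pmul2r d0) mulSn; lia.
  + by rewrite (q_state (i, w) _ _ _ e') // ltnW.
  + by rewrite -addnS (q_state (i, w) _ _ _ e').
- move=> [i w] [i' w'] A B /= /andP[Di ew] /andP[Di' ew'] Am Bm.
  have am : A %/ d < m by rewrite ltn_divLR.
  have bm : B %/ d < m by rewrite ltn_divLR.
  have ad : A %% d < d by rewrite ltn_mod.
  have bd : B %% d < d by rewrite ltn_mod.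
  have [c e] := edge i _ Di am; have [c' e'] := edge i' _ Di' bm.
  have qA := q_state (i, w) _ _ _ e (ltnW ad).
  have qA1 := q_state (i, w) _ _ _ e ad.
  have qB := q_state (i', w') _ _ _ e' (ltnW bd).
  have qB1 := q_state (i', w') _ _ _ e' bd.
  rewrite ?addnS -!divn_eq /= in qA qA1 qB qB1.
  rewrite qA qA1 qB qB1 => e1 e2.
  have [cc uu -> _] := state_arc od ew ew' ad bd e1 e2.
  congr (_, _); apply: (p4 _ _ _ _ Di Di' am bm uu).
  by rewrite e e' cc uu.
Qed.

(** * Assembling the cases *)

Lemma path_divides_edge : path_divides (@cube_adj 'I_1) 1.
Proof.
have par1 (x y : {ffun 'I_1 -> bool}) : parity x = parity y -> x = y.
  by rewrite /parity !big_ord1 => e; apply/ffunP=> i; rewrite ord1.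
have adj (x y : {ffun 'I_1 -> bool}) : cube_adj x y <-> parity x <> parity y.
  split=> [[i ->]|xy]; first by rewrite parity_flip; case: parity.
  exists ord0; apply: par1; rewrite parity_flip.
  by case: parity xy; case: parity.
exists (fun x y => ~~ parity x /\ parity y).
  split=> [x y|x y [xo yo] [yo' _]]; last by rewrite yo in yo'.
  rewrite adj; case: (parity x); case: (parity y);
  by split=> [h|[[]|[]]] //; auto.
exists unit, predT, (fun _ a => [ffun=> a == 1]); split.
- by move=> _ [|] // _ _; rewrite /parity !big_ord1 !ffunE.
- by move=> _ [|[|a]] // [|[|b]] // _ _ _ /ffunP/(_ ord0); rewrite !ffunE.
- move=> x y [xo yo]; exists tt, 0; split=> //; apply: par1.
    by rewrite [LHS]/parity big_ord1 ffunE (negPf xo).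
  by rewrite [LHS]/parity big_ord1 ffunE yo.
- by move=> [] [].
Qed.

(** For [k > 1], the largest power of two below [k] is even and leaves an odd remainder; the
    resulting paths are cut to length [2 ^ a]. *)
Lemma odd_cube_path_divides_pow k a : odd k -> 2 ^ a <= k ->
  path_divides (@cube_adj 'I_k) (2 ^ a).
Proof.
move=> ok ak; have k0 : 0 < k by case: (k) ok.
have [k1|k1] := leqP k 1.
  have -> : k = 1 by lia.
  have -> : a = 0 by case: a ak => // a; rewrite expnS; lia.
  exact: path_divides_edge.
have /andP[bk kb] := trunc_log_bounds (isT : 1 < 2) k0.
have ab : a <= trunc_log 2 k by apply: trunc_log_max.
have : 0 < trunc_log 2 k by rewrite trunc_log_gt0.
move: bk kb ab; case: (trunc_log 2 k) => // b bk kb ab _.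
apply: (@path_divides_mul _ _ _ (2 ^ (b.+1 - a))); first by rewrite expn_gt0.
rewrite -expnD subnKC //.
have -> : k = 2 ^ b.+1 + (k - 2 ^ b.+1) by rewrite subnKC.
apply: cube_path_divides_pow; last by move: kb; rewrite [2 ^ _.+2]expnS; lia.
by rewrite oddB // oddX /= ok.
Qed.

Theorem theorem5 (q m : nat) :
  odd q -> 0 < q -> q < 2 ^ 32 ->
  0 < m -> m <= q -> m %| q * 2 ^ (q - 1) ->
  graph_divides (path_edges m) (hcube_edges q).
Proof.
move=> oq q0 _ m0 mq mdvd; apply: path_graph_divides.
have [d od mE] := pfactor_coprime (isT : prime 2) m0.
rewrite mE in mq mdvd *; move: mq mdvd; set a := logn 2 m => mq mdvd.
(* The odd part [d] of [m] is coprime to the power of two. *)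
have /dvdnP[k qE] : d %| q.
  rewrite -(@Gauss_dvdl d q (2 ^ (q - 1))).
    exact: dvdn_trans (dvdn_mulr _ (dvdnn d)) mdvd.
  by rewrite coprimeXr // coprime_sym.
rewrite coprime2n in od; move: oq; rewrite qE oddM => /andP[ok _].
rewrite [d * _]mulnC; apply: path_divides_odd_mul => //.
apply: odd_cube_path_divides_pow => //.
have d0 : 0 < d by case: (d) od.
by move: mq; rewrite qE mulnC leq_pmul2r.
Qed.
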